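(* Let $K$ be a monoid with submonoids $G$ and $H$ such that $K=G\bowtie H$. Suppose that $G$ and $H$ are cancellative and conical, and that $G$ and $H$ act on each other by bijections. Then the map $G\times H\to K$ given by $(g,h)\mapsto g\vee h$ is a poset isomorphism $(G,\preccurlyeq_G)\times(H,\preccurlyeq_H)\to(K,\preccurlyeq_K)$. Similarly, the map $G\times H\to K$ given by $(g,h)\mapsto g\mathbin{\widetilde\vee}h$ is a poset isomorphism $(G,\succcurlyeq_G)\times(H,\succcurlyeq_H)\to(K,\succcurlyeq_K)$.
   Context: Zappa–Szép product: for a monoid $K$ with submonoids $G,H$, write $K=G\bowtie H$ if for every $k\in K$ there exist unique $g_1,g_2\in G$ and $h_1,h_2\in H$ such that $g_1h_1=k=h_2g_2$. Actions: for $g\in G$, $h\in H$ the elements $h\triangleright g\in G$, $h\triangleleft g\in H$, $g\blacktriangleright h\in H$, $g\blacktriangleleft h\in G$ are defined by $hg=(h\triangleright g)(h\triangleleft g)$ and $gh=(g\blacktriangleright h)(g\blacktriangleleft h)$. $G$ and $H$ act on each other by bijections if for all $h\in H$ the maps $g\mapsto h\triangleright g$ and $g\mapsto g\blacktriangleleft h$ are bijections of $G$, and for all $g\in G$ the maps $h\mapsto h\triangleleft g$ and $h\mapsto g\blacktriangleright h$ are bijections of $H$. A monoid is conical if $xy=\mathbf 1$ implies $x=\mathbf 1=y$. For a monoid $M$: $x\preccurlyeq_M y$ iff $y=xu$ for some $u\in M$; $y\succcurlyeq_M x$ iff $y=ux$ for some $u\in M$. Products of posets carry the componentwise order. $g\vee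 h$ denotes the least common upper bound of $g$ and $h$ in $K$ with respect to $\preccurlyeq_K$ (the prefix order), and $g\mathbin{\widetilde\vee}h$ the least common upper bound of $g$ and $h$ in $K$ with respect to the suffix order (in which $x$ lies below $y$ iff $y\succcurlyeq_K x$). Under the stated hypotheses, $\preccurlyeq$ and $\succcurlyeq$ are partial orders on $G,H,K$; the existence of these least upper bounds is part of the assertion. *)

(* Defs.v *)
From HB Require Import structures.
From mathcomp Require Import all_boot.
From mathcomp Require Import boolp classical_sets functions.

Set Implicit Arguments.
Unset Strict Implicit.
Unset Printing Implicit Defensive.

Local Open Scope classical_set_scope.
Local Open Scope group_scope.

Section Monoids.
Variable K : monoidType.
Implicit Types (M A B G H : set K) (k x y g h : K).

Definition submonoid M : Prop := M 1 /\ (forall x y, M x -> M y -> M (x * y)).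

Definition cancellative M : Prop :=
  (forall x y z, M x -> M y -> M z -> x * y = x * z -> y = z) /\
  (forall x y z, M x -> M y -> M z -> y * x = z * x -> y = z).

Definition conical M : Prop :=
  forall x y, M x -> M y -> x * y = 1 -> x = 1 /\ y = 1.

Definition factorizations A B k : set (K * K) :=
  [set p | A p.1 /\ B p.2 /\ p.1 * p.2 = k].

Definition zappa_szep G H : Prop :=
  forall k, (exists! p, factorizations G H k p) /\
            (exists! p, factorizations H G k p).

(* The pair (1, 1) is a junk value for elements without a factorization; it is
   never used when [zappa_szep A B] holds. *)
Definition factor A B k : K * K := xget (1, 1) (factorizations A B k).

(* For g in G and h in H:
     h * g = act_hg_G G H h g * act_hg_H G H h g    (h |> g in G,   h <| g in H)
     g * h = act_gh_H G H g h * act_gh_G G H g h    (g |>> h in H,  g <<| h in G),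
   where |>, <| stand for the white triangles and |>>, <<| for the black ones. *)
Definition act_hg_G G H h g : K := (factor G H (h * g)).1.
Definition act_hg_H G H h g : K := (factor G H (h * g)).2.
Definition act_gh_H G H g h : K := (factor H G (g * h)).1.
Definition act_gh_G G H g h : K := (factor H G (g * h)).2.

Definition act_by_bijections G H : Prop :=
  (forall h, H h -> set_bij G G (fun g => act_hg_G G H h g) /\
                    set_bij G G (fun g => act_gh_G G H g h)) /\
  (forall g, G g -> set_bij H H (fun h => act_hg_H G H h g) /\
                    set_bij H H (fun h => act_gh_H G H g h)).

Definition prefix_le M x y : Prop := exists2 u, M u & y = x * u.
Definition suffix_ge M y x : Prop := exists2 u, M u & y = u * x.

(* [suffix_ge] with its arguments exchanged, so that the smaller element comes
   first. *)
Definition suffix_le M x y : Prop := suffix_ge M y x.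

Definition is_lub (r : K -> K -> Prop) x y z : Prop :=
  (r x z /\ r y z) /\ (forall t, r x t -> r y t -> r z t).

(* The value is 1 if no least common upper bound exists. *)
Definition lub (r : K -> K -> Prop) x y : K := xget 1 [set z | is_lub r x y z].

Definition prefix_lub x y : K := lub (prefix_le [set: K]) x y.
Definition suffix_lub x y : K := lub (suffix_le [set: K]) x y.

End Monoids.

Definition partial_order_on (T : Type) (A : set T) (r : T -> T -> Prop) : Prop :=
  (forall x, A x -> r x x) /\
  (forall x y, A x -> A y -> r x y -> r y x -> x = y) /\
  (forall x y z, A x -> A y -> A z -> r x y -> r y z -> r x z).

Definition prod_order (T U : Type) (r : T -> T -> Prop) (s : U -> U -> Prop)
    (p q : T * U) : Prop :=
  r p.1 q.1 /\ s p.2 q.2.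

Definition poset_isomorphism (T U : Type) (A : set T) (r : T -> T -> Prop)
    (B : set U) (s : U -> U -> Prop) (f : T -> U) : Prop :=
  partial_order_on A r /\ partial_order_on B s /\ set_bij A B f /\
  (forall x y, A x -> A y -> (r x y <-> s (f x) (f y))).

(* Main.v *)
(**
For [g] in [G] and [h] in [H] there are unique [h'] in [H], [g'] in [G] with
[g h' = h g'] (bijectivity of one of the actions), and every [k] in [K] is such
a product for exactly one pair [(g, h)] (its two factorizations).  This [k] is
the join: if [t] is a common right multiple of [g] and [h], write [t = g u v]
and [t = h c d] with [u, c] in [H] and [v, d] in [G].  Uniqueness of
factorizations gives [g u = h c g2] for some [g2] in [G]; completing [(g', c)]
to [g' w = c z] gives [g (h' w) = h c z], so that [u = h' w] by uniqueness of
the completion of [(g, h c)], and [t = k w v].  The suffix half is the prefix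
half in the converse monoid.
*)
Require Import Defs.
From HB Require Import structures.
From mathcomp Require Import all_boot.
From mathcomp Require Import boolp classical_sets functions.

Set Implicit Arguments.
Unset Strict Implicit.
Unset Printing Implicit Defensive.

Local Open Scope classical_set_scope.

(** * Prefix orders, products and reversals of posets *)

Section Orders.
Local Open Scope group_scope.

Lemma partial_order_on_prod (T U : Type) (A : set T) (B : set U)
    (r : T -> T -> Prop) (s : U -> U -> Prop) :
  partial_order_on A r -> partial_order_on B s ->
  partial_order_on (A `*` B) (prod_order r s).
Proof.
move=> [rr [ra rt]] [sr [sa st]]; split; [|split].
- by move=> [x y] [/= Ax By]; split; [apply: rr | apply: sr].
- move=> [x y] [x' y'] [/= Ax By] [/= Ax' By'] [/= xx' yy'] [/= x'x y'y].
  by rewrite (ra x x') // (sa y y').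
- move=> [x1 y1] [x2 y2] [x3 y3] [/= ? ?] [/= ? ?] [/= ? ?].
  by move=> [/= ? ?] [/= ? ?]; split; [apply: (rt _ x2) | apply: (st _ y2)].
Qed.

(** Needed at the very end: the prefix order of the converse monoid is [suffix_le], whereas the
    suffix isomorphism is stated for [suffix_ge]. *)
Lemma poset_isomorphism_flip (T U : Type) (A : set T) (r : T -> T -> Prop)
    (B : set U) (s : U -> U -> Prop) (f : T -> U) :
  poset_isomorphism A r B s f ->
  poset_isomorphism A (fun x y => r y x) B (fun x y => s y x) f.
Proof.
have flip V (C : set V) (q : V -> V -> Prop) :
    partial_order_on C q -> partial_order_on C (fun x y => q y x).
  move=> [qr [qa qt]]; split; [exact: qr | split].
    by move=> x y Cx Cy yx xy; apply: qa.
  by move=> x y z Cx Cy Cz yx zy; apply: (qt _ y).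
move=> [rP [sP [fbij fmono]]]; split; [exact: flip | split; [exact: flip |]].
by split=> // x y Ax Ay; apply: fmono.
Qed.

Lemma partial_order_on_prefix (K : monoidType) (M : set K) :
  submonoid M -> cancellative M -> conical M ->
  partial_order_on M (prefix_le M).
Proof.
move=> [M1 MM] [cancM _] conM; split; [|split].
- by move=> x Mx; exists 1; rewrite ?mulg1.
- move=> x y Mx My [u Mu yE] [v Mv xE].
  have /(conM _ _ Mu Mv) [u1 _] : u * v = 1.
    apply: (cancM x); [exact: Mx | exact: MM | exact: M1 |].
    by rewrite mulg1 mulgA -yE -xE.
  by rewrite yE u1 mulg1.
- move=> x y z _ _ _ [u Mu ->] [v Mv ->].
  by exists (u * v); [exact: MM | rewrite mulgA].
Qed.

Lemma prefix_leT_trans (K : monoidType) (x y z : K) :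
  prefix_le setT x y -> prefix_le setT y z -> prefix_le setT x z.
Proof. by move=> [u _ ->] [v _ ->]; exists (u * v); rewrite // mulgA. Qed.

Lemma prefix_leW {K : monoidType} {M : set K} {x y : K} :
  prefix_le M x y -> prefix_le setT x y.
Proof. by move=> [u _ ->]; exists u. Qed.

End Orders.

(** * The converse monoid *)

Section Converse.
Local Open Scope group_scope.

(** A separate name for the carrier, so that the reversed product can be declared next to the
    original one. *)
Definition converse (K : monoidType) : Type := K.

Variable K : monoidType.

HB.instance Definition _ := Choice.on (converse K).

Fact converse_mulA :
  associative (fun x y : converse K => (y : K) * x : converse K).
Proof. by move=> x y z; rewrite mulgA. Qed.

Fact converse_mul1g :
  left_id (1 : K) (fun x y : converse K => (y : K) * x : converse K).
Proof. by move=> x; rewrite mulg1. Qed.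

Fact converse_mulg1 :
  right_id (1 : K) (fun x y : converse K => (y : K) * x : converse K).
Proof. by move=> x; rewrite mul1g. Qed.

HB.instance Definition _ :=
  isMonoid.Build (converse K) converse_mulA converse_mul1g converse_mulg1.

End Converse.

(** * Unique factorizations and commuting squares *)

Section Factorizations.
Local Open Scope group_scope.
Variable K : monoidType.
Implicit Types (A B G H : set K).

Lemma factorizations_converse A B :
  (forall k, exists! p, factorizations B A k p) ->
  forall k : converse K,
    exists! p, @factorizations (converse K) (A : set (converse K)) B k p.
Proof.
move=> fac k; have [[b a] [[/= Bb [Aa ba]] uniq]] := fac k.
exists (a, b); split=> [|[a' b'] [/= Aa' [Bb' ba']]]; first by split.
have : (b, a) = (b', a') by apply: uniq; split.
by move=> -[-> ->].
Qed.

Lemma factorization_inj A B a b a' b' :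
  (forall k, exists! p, factorizations A B k p) ->
  A a -> B b -> A a' -> B b' -> a * b = a' * b' -> a = a' /\ b = b'.
Proof.
move=> fac Aa Bb Aa' Bb' e; have [p [_ uniq]] := fac (a * b).
have pE : p = (a, b) by apply: uniq.
have : p = (a', b') by apply: uniq; rewrite e; split.
by rewrite pE => -[].
Qed.

Lemma factorP A B k :
  (forall k, exists! p, factorizations A B k p) ->
  factorizations A B k (factor A B k).
Proof.
by move=> fac; apply: xgetPex; have [p [? _]] := fac k; exists p.
Qed.

(** The ways to close [g] and [h] to a commuting square; the diagonal [g * p.1] is the future
    join. *)
Definition completion G H g h : set (K * K) :=
  [set p | H p.1 /\ G p.2 /\ g * p.1 = h * p.2].

(* Stated for an arbitrary [act] so that it covers one white action in [K] and
   one black action in the converse of [K]. *)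
Lemma completion_uniq_ex G H (act : K -> K -> K) :
  (forall k, exists! p, factorizations G H k p) ->
  (forall g h, G g -> H h ->
     G (act h g) /\ exists2 h', H h' & h * g = act h g * h') ->
  (forall h, H h -> set_bij G G (act h)) ->
  forall g h, G g -> H h -> exists! p, completion G H g h p.
Proof.
move=> fac actP bij g h Gg Hh; have [_ inj surj] := bij h Hh.
(* Choosing [g'] with [act h g' = g] makes [g] the [G]-part of [h * g']; the [H]-part is then
   [h']. *)
have [g' Gg' g'E] := surj g Gg.
have [_ [h' Hh' e]] := actP g' h Gg' Hh; rewrite g'E in e.
exists (h', g'); split=> [|[h2 g2] [/= Hh2 [Gg2 e2]]]; first by [].
have [Ga [h3 Hh3 e3]] := actP g2 h Gg2 Hh.
have [ga _] : g = act h g2 /\ h2 = h3.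
  by apply: (factorization_inj fac) => //; rewrite e2.
have g2E : g' = g2 by apply: inj; rewrite ?inE // g'E.
subst g2.
(* Uniqueness of factorizations cancels [g] from [g * h' = g * h2]. *)
have [_ ->] // : g = g /\ h' = h2.
by apply: (factorization_inj fac) => //; rewrite e2 e.
Qed.

End Factorizations.

(** * Joins for the prefix order *)

Section PrefixJoin.
Local Open Scope group_scope.
Variables (K : monoidType) (G H : set K).
Hypotheses (subG : submonoid G) (subH : submonoid H).
Hypothesis facGH : forall k, exists! p, factorizations G H k p.
Hypothesis facHG : forall k, exists! p, factorizations H G k p.
Hypothesis complete :
  forall g h, G g -> H h -> exists! p, completion G H g h p.

Lemma is_lub_completion g h h' g' :
  G g -> H h -> completion G H g h (h', g') ->
  is_lub (prefix_le [set: K]) g h (g * h').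
Proof.
move=> Gg Hh [/= Hh' [Gg' e]]; split.
  by split; [exists h' | exists g'].
move=> t [x _ tx] [y _ ty].
have [[u v] [[/= Hu [Gv uv]] _]] := facHG x.
have [[c d] [[/= Hc [Gd cd]] _]] := facHG y.
have [[u2 g2] [[/= Hu2 [Gg2 ug2]] _]] := facHG (g * u).
(* Both [u2 * (g2 * v)] and [(h * c) * d] factor [t] over [H] and [G]. *)
have [u2E _] : u2 = h * c /\ g2 * v = d.
  apply: (factorization_inj facHG) => //.
  - exact: subG.2.
  - exact: subH.2.
  - by rewrite mulgA ug2 -[_ * c * d]mulgA cd -ty tx -uv mulgA.
have [[w z] [[/= Hw [Gz wz]] _]] := complete Gg' Hc.
have [p [_ uniq]] := complete Gg (subH.2 _ _ Hh Hc).
have pu : p = (u, g2) by apply: uniq; rewrite /completion /= -u2E ug2.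
have pw : p = (h' * w, z).
  apply: uniq; split; [exact: subH.2 | split=> //=].
  by rewrite mulgA e -[h * g' * w]mulgA wz mulgA.
have [uE _] : u = h' * w /\ g2 = z by move: pw; rewrite pu => -[].
by exists (w * v); rewrite // tx -uv uE !mulgA.
Qed.

(** Factoring the cofactor as [u * v] yields a second factorization [(a * u) * v] of [g * b], whence
    [g = a * u]. *)
Lemma prefix_le_factor A B a g b :
  (forall k, exists! p, factorizations A B k p) -> submonoid A ->
  A a -> A g -> B b -> prefix_le [set: K] a (g * b) -> prefix_le A a g.
Proof.
move=> fac [_ AM] Aa Ag Bb [x _ e].
have [[u v] [[/= Au [Bv uv]] _]] := fac x.
exists u => //.
have [//] : g = a * u /\ b = v.
by apply: (factorization_inj fac) => //; [exact: AM | rewrite e -uv mulgA].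
Qed.

(** Leastness of the join gives one direction. For the other, [prefix_le_factor] is applied to both
    factorizations of the larger join, [g2 * h2'] and [h2 * g2']. *)
Lemma prefix_le_completion g h h' g' g2 h2 h2' g2' :
  G g -> H h -> completion G H g h (h', g') ->
  G g2 -> H h2 -> completion G H g2 h2 (h2', g2') ->
  prefix_le [set: K] (g * h') (g2 * h2') <-> prefix_le G g g2 /\ prefix_le H h h2.
Proof.
move=> Gg Hh c Gg2 Hh2 c2.
have [[gk hk] lubk] := is_lub_completion Gg Hh c.
have [[gt ht] _] := is_lub_completion Gg2 Hh2 c2.
have [/= Hh2' [Gg2' e2]] := c2.
split=> [kt | [gg2 hh2]]; last first.
  apply: lubk; [exact: prefix_leT_trans (prefix_leW gg2) gt |].
  exact: prefix_leT_trans (prefix_leW hh2) ht.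
split.
  apply: (prefix_le_factor facGH subG Gg Gg2 Hh2').
  exact: prefix_leT_trans gk kt.
apply: (prefix_le_factor facHG subH Hh Hh2 Gg2').
by rewrite -e2; apply: prefix_leT_trans hk kt.
Qed.

Lemma exists_completion k :
  exists g h h' g', [/\ G g, H h, completion G H g h (h', g') & k = g * h'].
Proof.
have [[g h'] [[/= Gg [Hh' gh]] _]] := facGH k.
have [[h g'] [[/= Hh [Gg' hg]] _]] := facHG k.
by exists g, h, h', g'; split=> //; split=> //; split=> //=; rewrite gh hg.
Qed.

Hypotheses (cancG : cancellative G) (cancH : cancellative H).
Hypotheses (conG : conical G) (conH : conical H).

(** Antisymmetry is inherited from [G] and [H]: elements that are prefixes of each other come from
    the same pair, and the completion of that pair is unique. *)
Lemma partial_order_on_prefixT : partial_order_on setT (prefix_le [set: K]).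
Proof.
split; [|split].
- by move=> x _; exists 1; rewrite ?mulg1.
- move=> x y _ _.
  have [g [h [h' [g' [Gg Hh c ->]]]]] := exists_completion x.
  have [g2 [h2 [h2' [g2' [Gg2 Hh2 c2 ->]]]]] := exists_completion y.
  move=> /(prefix_le_completion Gg Hh c Gg2 Hh2 c2) [gg2 hh2].
  move=> /(prefix_le_completion Gg2 Hh2 c2 Gg Hh c) [g2g h2h].
  have [_ [antiG _]] := partial_order_on_prefix subG cancG conG.
  have [_ [antiH _]] := partial_order_on_prefix subH cancH conH.
  have gE := antiG _ _ Gg Gg2 gg2 g2g; have hE := antiH _ _ Hh Hh2 hh2 h2h.
  subst g2 h2; have [p [_ uniq]] := complete Gg Hh.
  by move: (uniq _ c2); rewrite (uniq _ c) => -[-> _].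
- by move=> x y z _ _ _; apply: prefix_leT_trans.
Qed.

Lemma prefix_lubE g h h' g' :
  G g -> H h -> completion G H g h (h', g') -> prefix_lub g h = g * h'.
Proof.
move=> Gg Hh c; have lubk := is_lub_completion Gg Hh c.
(* By antisymmetry no other least upper bound can be the one that [xget] picks. *)
apply: xget_unique => //= z [[gz hz] lubz].
have [_ [anti _]] := partial_order_on_prefixT.
by apply: anti => //; [apply: lubz; apply lubk | apply: lubk.2].
Qed.

Lemma prefix_lub_isomorphism :
  (forall g h, G g -> H h ->
     is_lub (prefix_le [set: K]) g h (prefix_lub g h)) /\
  poset_isomorphism
    (G `*` H) (prod_order (prefix_le G) (prefix_le H))
    [set: K] (prefix_le [set: K])
    (fun p => prefix_lub p.1 p.2).
Proof.
have poGH := partial_order_on_prod (partial_order_on_prefix subG cancG conG)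
               (partial_order_on_prefix subH cancH conH).
have mono p q : (G `*` H) p -> (G `*` H) q ->
    prod_order (prefix_le G) (prefix_le H) p q <->
    prefix_le [set: K] (prefix_lub p.1 p.2) (prefix_lub q.1 q.2).
  case: p q => [g h] [g2 h2] [/= Gg Hh] [/= Gg2 Hh2].
  have [[h' g'] [c _]] := complete Gg Hh.
  have [[h2' g2'] [c2 _]] := complete Gg2 Hh2.
  rewrite (prefix_lubE Gg Hh c) (prefix_lubE Gg2 Hh2 c2).
  by split=> /(prefix_le_completion Gg Hh c Gg2 Hh2 c2).
split=> [g h Gg Hh|].
  have [[h' g'] [c _]] := complete Gg Hh.
  by rewrite (prefix_lubE Gg Hh c); apply: is_lub_completion c.
split; [exact: poGH | split; [exact: partial_order_on_prefixT | split=> //]].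
split=> //.
(* Equal joins are comparable both ways, so [mono] and antisymmetry of the product order give
   injectivity. *)
- move=> p q; rewrite !inE => Ap Aq e; apply: poGH.2.1 => //.
    by apply/(mono _ _ Ap Aq); rewrite e; exists 1; rewrite ?mulg1.
  by apply/(mono _ _ Aq Ap); rewrite e; exists 1; rewrite ?mulg1.
- move=> k _; have [g [h [h' [g' [Gg Hh c ->]]]]] := exists_completion k.
  by exists (g, h); [split | rewrite /= (prefix_lubE Gg Hh c)].
Qed.

End PrefixJoin.

Theorem theorem30 (K : monoidType) (G H : set K)
    (subG : submonoid G) (subH : submonoid H)
    (zsGH : zappa_szep G H)
    (cancG : cancellative G) (cancH : cancellative H)
    (conG : conical G) (conH : conical H)
    (bijGH : act_by_bijections G H) :
  ((forall g h, G g -> H h ->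
      is_lub (prefix_le [set: K]) g h (prefix_lub g h)) /\
   poset_isomorphism
     (G `*` H) (prod_order (prefix_le G) (prefix_le H))
     [set: K] (prefix_le [set: K])
     (fun p => prefix_lub p.1 p.2)) /\
  ((forall g h, G g -> H h ->
      is_lub (suffix_le [set: K]) g h (suffix_lub g h)) /\
   poset_isomorphism
     (G `*` H) (prod_order (suffix_ge G) (suffix_ge H))
     [set: K] (suffix_ge [set: K])
     (fun p => suffix_lub p.1 p.2)).
Proof.
have facGH k := (zsGH k).1; have facHG k := (zsGH k).2.
split.
  apply: prefix_lub_isomorphism => //.
  apply: (completion_uniq_ex (act := act_hg_G G H)) => // [g h Gg Hh|h /bijGH.1[]//].
  have [Ga [Hb e]] := factorP (h * g)%g facGH.
  by split=> //; exists (act_hg_H G H h g).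
have conv (M : set K) : submonoid M -> cancellative M -> conical M ->
    [/\ @submonoid (converse K) M, @cancellative (converse K) M
      & @conical (converse K) M].
  move=> [M1 MM] [cl cr] con; split; [split=> // | by split |].
    by move=> x y Mx My; apply: MM.
  by move=> x y Mx My xy; have [-> ->] := con y x My Mx xy.
have [subG' cancG' conG'] := conv G subG cancG conG.
have [subH' cancH' conH'] := conv H subH cancH conH.
(* Reversing products exchanges the two kinds of factorization. *)
have facGH' := factorizations_converse facHG.
have facHG' := factorizations_converse facGH.
have complete' (g h : converse K) :
    G g -> H h -> exists! p, @completion (converse K) G H g h p.
  move: g h.
  (* In the converse monoid the [G]-part of [g * h] comes first, so the black action on [G] takes
     the place of the white one. *)
  apply: (@completion_uniq_ex (converse K) G H (fun h g => act_gh_G G H g h)) => //.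
  - move=> g h Gg Hh; have [Hb [Ga e]] := @factorP K H G ((g : K) * h)%g facHG.
    by split=> //; exists (act_gh_H G H g h).
  - by move=> h /bijGH.1[].
have [lubs iso] := prefix_lub_isomorphism subG' subH' facGH' facHG' complete'
  cancG' cancH' conG' conH'.
split; first exact: lubs.
exact: (poset_isomorphism_flip iso).
Qed.
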